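(* For each $\nu>0$ let $\mathbf u_\nu\in\mathbf H_0^1(\Omega)$ be the solution of $$\mu\int_\Omega\mathcal E\mathbf u_\nu:\mathcal E\mathbf v\,dx+g\beta\int_\Omega\frac{\mathcal E\mathbf u_\nu:\mathcal E\mathbf v}{\max(g,\beta|\mathcal E\mathbf u_\nu|)}\,dx+\nu\int_\Omega(\operatorname{div}\mathbf u_\nu)(\operatorname{div}\mathbf v)\,dx=\int_\Omega\mathbf f\cdot\mathbf v\,dx,\quad\forall\,\mathbf v\in\mathbf H_0^1(\Omega).$$ Let $\mathbf u\in\mathbf H_0^1(\Omega)$, with $\operatorname{div}\mathbf u=0$, be the solution, with associated pressure $p\in L_0^2(\Omega)$, of $$\mu\int_\Omega\mathcal E\mathbf u:\mathcal E\mathbf v\,dx+g\beta\int_\Omega\frac{\mathcal E\mathbf u:\mathcal E\mathbf v}{\max(g,\beta|\mathcal E\mathbf u|)}\,dx-\int_\Omega p\,\operatorname{div}\mathbf v\,dx=\int_\Omega\mathbf f\cdot\mathbf v\,dx,\quad\forall\,\mathbf v\in\mathbf H_0^1(\Omega).$$ Then $\mathbf u_\nu\to\mathbf u$ in $\mathbf H_0^1(\Omega)$ as $\nu\to\infty$.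
   Context: $\Omega\subset\mathbb R^n$, $n\in\{2,3\}$, is open and bounded with Lipschitz boundary; $\mathbf H_0^1(\Omega)=(H_0^1(\Omega))^n$; $L_0^2(\Omega)$ is the space of $L^2(\Omega)$ functions with zero mean. $\mathcal E\mathbf u$ is the symmetric gradient with entries $\mathcal E_{ij}(\mathbf u)=\frac12\left(\frac{\partial u_i}{\partial x_j}+\frac{\partial u_j}{\partial x_i}\right)$; $A:B=\mathrm{tr}(AB^\top)$ and $|A|=\sqrt{A:A}$. The constants $\mu,g,\beta>0$ are fixed, and $\mathbf f$ is such that $\mathbf v\mapsto\int_\Omega\mathbf f\cdot\mathbf v\,dx$ is a continuous linear functional on $\mathbf H_0^1(\Omega)$. *)

(* Defs.v *)
From HB Require Import structures.
From mathcomp Require Import all_boot all_order all_algebra.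
From mathcomp Require Import all_classical all_reals all_analysis.

Set Implicit Arguments.
Unset Strict Implicit.
Unset Printing Implicit Defensive.
Import Order.TTheory GRing.Theory Num.Theory.
Import numFieldNormedType.Exports.

Local Open Scope classical_set_scope.
Local Open Scope ring_scope.

(* 'rV[R]_n carries the product sigma-algebra, as the library's n.-tuple does;
   it is the Borel sigma-algebra of R^n. *)
Section measurable_rV.
Context {R : realType} (n : nat).

Let coord (i : 'I_n) (x : 'rV[R]_n) : R := x ord0 i.

Let rV_set0 : g_sigma_preimage coord set0.
Proof. exact: sigma_algebra0. Qed.

Let rV_setC A : g_sigma_preimage coord A -> g_sigma_preimage coord (~` A).
Proof. exact: sigma_algebraC. Qed.

Let rV_bigcup (F : _^nat) : (forall i, g_sigma_preimage coord (F i)) ->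
  g_sigma_preimage coord (\bigcup_i (F i)).
Proof. exact: sigma_algebra_bigcup. Qed.

HB.instance Definition _ :=
  @isMeasurable.Build (measure_tuple_display default_measure_display)
  'rV[R]_n (g_sigma_preimage coord) rV_set0 rV_setC rV_bigcup.

End measurable_rV.

Section lebesgue_rV.
Context {R : realType}.

Lemma measurable_coord n (i : 'I_n) :
  measurable_fun [set: 'rV[R]_n] (fun x : 'rV[R]_n => x ord0 i).
Proof.
move=> _ Y mY; rewrite setTI; apply: sub_sigma_algebra => /=.
rewrite -bigcup_seq/=; exists i => /=; first by rewrite mem_index_enum.
by exists Y => //; rewrite setTI.
Qed.

Lemma measurable_fun_rV d (T : measurableType d) n (f : T -> 'rV[R]_n) :
  (forall i, measurable_fun [set: T] (fun t => f t ord0 i)) ->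
  measurable_fun [set: T] f.
Proof.
move=> mf _ Y mY; rewrite setTI.
pose D := [set A | d.-measurable (f @^-1` A)].
suff : measurable `<=` D by exact.
apply: smallest_sub; rewrite /D.
  split => /=; first by rewrite preimage_set0.
    by move=> A mA; rewrite setTD preimage_setC; exact: measurableC.
  by move=> F mF; rewrite preimage_bigcup; exact: bigcup_measurable.
move=> B; rewrite -bigcup_seq/= => -[i _ [A mA <-]] /=.
by rewrite setTI -comp_preimage -[X in measurable X]setTI; exact: mf.
Qed.

Definition cons_rV n (p : measurableTypeR R * 'rV[R]_n) : 'rV[R]_n.+1 :=
  row_mx (p.1 : R)%:M p.2.

Lemma measurable_cons_rV n : measurable_fun [set: measurableTypeR R * 'rV[R]_n]
  (@cons_rV n).
Proof.
apply: measurable_fun_rV => i; rewrite /cons_rV.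
case: (@split_ordP 1 n i) => j ->.
  rewrite (_ : (fun _ => _) = fst); first exact: measurable_fst.
  by apply/funext => p /=; rewrite [LHS]row_mxEl (ord1 j) mxE eqxx mulr1n.
rewrite (_ : (fun _ => _) = (fun x : 'rV[R]_n => x ord0 j) \o snd).
  exact: (measurableT_comp (measurable_coord j) measurable_snd).
by apply/funext => p /=; rewrite [LHS]row_mxEr.
Qed.



Section lebesgue_rV_succ.
Context n (m : {sigma_finite_measure set 'rV[R]_n -> \bar R}).

(* R^(n+1) is measured as R * R^n through cons_rV. *)
Definition lebesgue_rV_succ : set 'rV[R]_n.+1 -> \bar R :=
  pushforward ((@lebesgue_measure R) \x m)%E (@cons_rV n).

Let lebesgue_rV_succ0 : lebesgue_rV_succ set0 = 0%E.
Proof. by rewrite /lebesgue_rV_succ /pushforward preimage_set0 measure0. Qed.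

Let lebesgue_rV_succ_ge0 A : (0 <= lebesgue_rV_succ A)%E.
Proof. by rewrite /lebesgue_rV_succ /pushforward; exact: measure_ge0. Qed.

Let preim A : measurable A -> measurable (@cons_rV n @^-1` A).
Proof.
by move=> mA; rewrite -[X in measurable X]setTI; exact: measurable_cons_rV.
Qed.

Let lebesgue_rV_succ_sigma_additive : semi_sigma_additive lebesgue_rV_succ.
Proof.
move=> F mF tF mUF; rewrite /lebesgue_rV_succ /pushforward preimage_bigcup.
apply: measure_semi_sigma_additive.
- by move=> k; exact: preim.
- apply/trivIsetP => i j _ _ ij; rewrite -preimage_setI.
  by move/trivIsetP : tF => /(_ _ _ Logic.I Logic.I ij) ->; rewrite preimage_set0.
- by rewrite -preimage_bigcup; exact: preim.
Qed.

HB.instance Definition _ := isMeasure.Build _ _ _ lebesgue_rV_succ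
  lebesgue_rV_succ0 lebesgue_rV_succ_ge0 lebesgue_rV_succ_sigma_additive.

Let lebesgue_rV_succ_sigma_finite : sigma_finite setT lebesgue_rV_succ.
Proof.
have /sigma_finiteP[F [FT ndF Foo]] := sigma_finiteT (@lebesgue_measure R).
have /sigma_finiteP[G [GT ndG Goo]] := sigma_finiteT m.
pose uncons (x : 'rV[R]_n.+1) : measurableTypeR R * 'rV[R]_n :=
  (x ord0 ord0, rsubmx (x : 'rV_(1 + n))).
have unconsK p : uncons (cons_rV p) = p.
  case: p => a y; rewrite /uncons /cons_rV row_mxKr; congr pair => /=.
  have e0 : ord0 = lshift n ord0 :> 'I_(1 + n) by exact/val_inj.
  have := row_mxEl (a%:M : 'M[R]_1) y ord0 ord0.
  by rewrite -e0 [RHS]mxE eqxx mulr1n.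
have muncons : measurable_fun setT uncons.
  apply: measurable_fun_pair; first exact: measurable_coord.
  apply: measurable_fun_rV => i.
  by under eq_fun do rewrite mxE; exact: measurable_coord.
have mFG k : measurable (F k `*` G k).
  by apply: measurableX; [exact: (Foo k).1|exact: (Goo k).1].
exists (fun k => uncons @^-1` (F k `*` G k)).
  rewrite -preimage_bigcup (_ : \bigcup_k _ = setT) ?preimage_setT//.
  rewrite -subTset => -[x y] _.
  have [i _ Fx] : (\bigcup_k F k) x by rewrite -FT.
  have [j _ Gy] : (\bigcup_k G k) y by rewrite -GT.
  exists (maxn i j) => //; split => /=.
    by move: x Fx; exact/subsetPset/ndF/leq_maxl.
  by move: y Gy; exact/subsetPset/ndG/leq_maxr.
move=> k; split; first by rewrite -[X in measurable X]setTI; exact: muncons.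
rewrite /lebesgue_rV_succ /pushforward -comp_preimage.
rewrite (_ : uncons \o _ = id) ?preimage_id; last first.
  by apply/funext => p /=; rewrite unconsK.
have [[mF Fk] [mG Gk]] := (Foo k, Goo k).
by rewrite product_measure1E// lte_mul_pinfty// ge0_fin_numE.
Qed.

HB.instance Definition _ := Measure_isSigmaFinite.Build _ _ _ lebesgue_rV_succ
  lebesgue_rV_succ_sigma_finite.

End lebesgue_rV_succ.

(* R^0 is a point, of mass 1. *)
Definition lebesgue_rV0 : set 'rV[R]_0 -> \bar R := \d_(0 : 'rV[R]_0).

HB.instance Definition _ := Measure.on lebesgue_rV0.

Let lebesgue_rV0_sigma_finite : sigma_finite setT lebesgue_rV0.
Proof.
apply: fin_num_fun_sigma_finite; first by rewrite measure0.
by move=> A _; rewrite /lebesgue_rV0 diracE.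
Qed.

HB.instance Definition _ :=
  Measure_isSigmaFinite.Build _ _ _ lebesgue_rV0 lebesgue_rV0_sigma_finite.

Fixpoint lebesgue_rV n : {sigma_finite_measure set 'rV[R]_n -> \bar R} :=
  if n is k.+1 then lebesgue_rV_succ (lebesgue_rV k) else lebesgue_rV0.

End lebesgue_rV.
Arguments lebesgue_rV {R} n.

Section domains.
Context {R : realType} (n : nat).
Implicit Type Om : set 'rV[R]_n.

(* Near each boundary point, Om is the strict epigraph of a Lipschitz function
   of n - 1 variables, in the orthonormal coordinates y = x *m Q with y_k as
   the vertical variable. *)
Definition lipschitz_boundary Om :=
  forall x0, (closure Om `\` Om°) x0 ->
  exists (Q : 'M[R]_n) (k : 'I_n) (gamma : 'rV[R]_n.-1 -> R),
    [/\ Q *m Q^T = 1%:M, lipschitz gamma &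
        \forall x \near x0,
          Om x <-> gamma (col' k (x *m Q)) < (x *m Q) ord0 k].

End domains.

Section sobolev.
Context {R : realType} (n : nat).
Implicit Types (Om : set 'rV[R]_n) (h : 'rV[R]_n -> R).

Definition partial (j : 'I_n) h : 'rV[R]_n -> R :=
  fun x => 'D_(delta_mx ord0 j) h x.

(* C^oo: all iterated partial derivatives are differentiable everywhere. *)
Definition smooth h :=
  forall (js : seq 'I_n) x, differentiable (foldr partial h js) x.

Definition supp h : set 'rV[R]_n := closure [set x | h x != 0].

(* C_c^oo(Om), extended by zero outside Om *)
Definition test_function Om h :=
  [/\ smooth h, compact (supp h) & supp h `<=` Om].

Definition L2 Om h :=
  measurable_fun Om h /\
  (lebesgue_rV n).-integrable Om (fun x => (h x ^+ 2)%:E).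

Definition L2_0 Om h :=
  L2 Om h /\ \int[lebesgue_rV n]_(x in Om) h x = 0.

Definition weak_partial Om (j : 'I_n) h dh :=
  forall psi, test_function Om psi ->
    \int[lebesgue_rV n]_(x in Om) (h x * partial j psi x) =
    - \int[lebesgue_rV n]_(x in Om) (dh x * psi x).

Implicit Types (w : 'rV[R]_n -> 'rV[R]_n) (Dw : 'rV[R]_n -> 'M[R]_n).

Definition jac w : 'rV[R]_n -> 'M[R]_n :=
  fun x => \matrix_(i, j) partial j (fun y => w y ord0 i) x.

(* H^1 norm over Om of a field w whose gradient is Dw.  Rintegral sends an
   infinite integral to 0, so this is meaningful for square-integrable w, Dw
   only. *)
Definition H1norm Om w Dw : R := Num.sqrt
  (\int[lebesgue_rV n]_(x in Om)
     (\sum_i w x ord0 i ^+ 2 + \sum_i \sum_j Dw x i j ^+ 2)).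

(* (H^1(Om))^n: a field together with its weak gradient, (grad v x) i j being
   the derivative of the i-th component in the j-th direction.  Both are
   representatives, relevant only up to null sets of Om. *)
Record H1 Om := MkH1 {
  H1_fun :> 'rV[R]_n -> 'rV[R]_n ;
  grad : 'rV[R]_n -> 'M[R]_n ;
  H1_fun_L2 : forall i, L2 Om (fun x => H1_fun x ord0 i) ;
  grad_L2 : forall i j, L2 Om (fun x => grad x i j) ;
  grad_weak : forall i j,
    weak_partial Om j (fun x => H1_fun x ord0 i) (fun x => grad x i j) }.

(* (H_0^1(Om))^n: the closure of (C_c^oo(Om))^n in the H^1 norm. *)
Record H01 Om := MkH01 {
  H01_H1 :> H1 Om ;
  H01_approx : forall e : R, 0 < e -> exists phi : 'rV[R]_n -> 'rV[R]_n,
    (forall i, test_function Om (fun x => phi x ord0 i)) /\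
    H1norm Om (fun x => H01_H1 x - phi x)
              (fun x => grad H01_H1 x - jac phi x) < e }.

Definition H1dist Om (u v : H1 Om) : R :=
  H1norm Om (fun x => u x - v x) (fun x => grad u x - grad v x).

Definition symgrad Om (v : H1 Om) : 'rV[R]_n -> 'M[R]_n :=
  fun x => 2^-1 *: (grad v x + (grad v x)^T).

Definition div Om (v : H1 Om) : 'rV[R]_n -> R := fun x => \tr (grad v x).

Definition frob (A B : 'M[R]_n) : R := \tr (A *m B^T).

Definition frobnorm (A : 'M[R]_n) : R := Num.sqrt (frob A A).

Definition dotv (a b : 'rV[R]_n) : R := \sum_i a ord0 i * b ord0 i.

(* v |-> \int_Om f . v is a well-defined continuous linear functional on
   (H_0^1(Om))^n; linearity is automatic once every f . v is integrable. *)
Definition continuous_load Om (f : 'rV[R]_n -> 'rV[R]_n) :=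
  (forall v : H01 Om,
     (lebesgue_rV n).-integrable Om (fun x => (dotv (f x) (v x))%:E)) /\
  exists C : R, forall v : H01 Om,
    `|\int[lebesgue_rV n]_(x in Om) dotv (f x) (v x)| <=
    C * H1norm Om v (grad v).

End sobolev.

(* Main.v *)
(* With w = u_nu - u as test function in both problems, the load cancels.  The
   regularized plastic term A / max(g, beta |A|) is monotone and div u = 0, so
     mu |E w|^2 + nu |div w|^2 <= - int p div w <= nu |div w|^2 + |p|^2 / (4 nu)
   in L^2 norms, hence |E w|^2 <= |p|^2 / (4 mu nu).  Korn's and Poincare's
   inequalities in H_0^1 turn this into |w|_{H^1}^2 <= K / nu.

   Both inequalities come from the definition of the weak gradient D v of
   v in H_0^1, tested against functions built from test functions phi
   approximating v, so that no integration by parts is ever proved: testing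
   with d_i phi_j and d_j phi_j, where d_j d_i phi_j = d_i d_j phi_j, gives
   int D_j v_i D_i v_j = int D_i v_i D_j v_j (Korn), and testing with x_k phi_i
   gives |v_i|^2 = - 2 int x_k v_i D_k v_i (Poincare). *)

Require Import Defs.
From HB Require Import structures.
From mathcomp Require Import all_boot all_order all_algebra.
From mathcomp Require Import all_classical all_reals all_analysis.
From mathcomp Require Import measurable_realfun ring lra.

Set Implicit Arguments.
Unset Strict Implicit.
Unset Printing Implicit Defensive.
Import Order.TTheory GRing.Theory Num.Theory.
Import numFieldNormedType.Exports.

Local Open Scope classical_set_scope.
Local Open Scope ring_scope.

(** * Square-integrable functions *)

(** A quadratic that is nonnegative for every [t] has no two distinct roots. Both Cauchy-Schwarz
    inequalities below, for integrals and for matrices, come from it. *)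
Lemma discriminant_le (R : realType) (a b c : R) : 0 <= a ->
  (forall t, 0 <= t ^+ 2 * a + 2 * t * b + c) -> b ^+ 2 <= a * c.
Proof.
move=> a0 H; have [ae0|an0] := eqVneq a 0.
  have [->|bn0] := eqVneq b 0; first by rewrite expr0n/= ae0 mul0r.
  (* For [a = 0] the polynomial is affine, and at this [t] it equals -1, which is absurd. *)
  have := H (- (c + 1) / (2 * b)).
  rewrite ae0 mulr0 add0r.
  have -> : 2 * (- (c + 1) / (2 * b)) * b = - (c + 1) by field.
  by lra.
have ap : 0 < a by rewrite lt_def an0.
(* The minimizer of the quadratic. *)
have := H (- b / a).
have -> : (- b / a) ^+ 2 * a + 2 * (- b / a) * b + c = (a * c - b ^+ 2) / a by field.
by rewrite pmulr_lge0 ?invr_gt0// subr_ge0.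
Qed.

Section square_integrable.
Context d (T : measurableType d) (R : realType).
Variables (mu : {measure set T -> \bar R}) (D : set T) (mD : measurable D).
Implicit Types f g h : T -> R.

(** [L2 Om h] unfolds to this with the measure [lebesgue_rV n] and the set [Om], so the lemmas of
    this section apply to [L2] directly. *)
Definition sq_integrable f :=
  measurable_fun D f /\ mu.-integrable D (fun x => (f x ^+ 2)%:E).

Definition ip f g : R := \int[mu]_(x in D) (f x * g x).

Definition l2norm f : R := Num.sqrt (ip f f).

Lemma le_integrable_real f g : measurable_fun D f ->
  mu.-integrable D (EFin \o g) -> (forall x, D x -> `|f x| <= g x) ->
  mu.-integrable D (EFin \o f).
Proof.
move=> mf ig fg; apply: (le_integrable mD _ _ ig).
  exact/measurable_EFinP.
by move=> x Dx /=; rewrite lee_fin (le_trans (fg x Dx))// ler_norm.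
Qed.

Lemma integrable_realD f g : mu.-integrable D (EFin \o f) ->
  mu.-integrable D (EFin \o g) ->
  mu.-integrable D (EFin \o (fun x => f x + g x)).
Proof. exact: (@integrableD _ _ _ mu D mD (EFin \o f) (EFin \o g)). Qed.

Lemma integrable_realZ k f : mu.-integrable D (EFin \o f) ->
  mu.-integrable D (EFin \o (fun x => k * f x)).
Proof. exact: (@integrableZl _ _ _ mu D mD k (EFin \o f)). Qed.

Lemma integrable_sqM f g : sq_integrable f -> sq_integrable g ->
  mu.-integrable D (EFin \o (fun x => f x * g x)).
Proof.
move=> [mf sf] [mg sg].
apply: (@le_integrable_real _ (fun x => f x ^+ 2 + g x ^+ 2)).
- exact: measurable_funM.
- exact: integrable_realD.
- move=> x _; rewrite ler_norml; apply/andP; split; nra.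
Qed.

Lemma sq_integrableD f g : sq_integrable f -> sq_integrable g ->
  sq_integrable (fun x => f x + g x).
Proof.
move=> [mf sf] [mg sg]; split; first exact: measurable_funD.
apply: (@le_integrable_real _ (fun x => 2 * (f x ^+ 2 + g x ^+ 2))).
- by apply: measurable_funX; exact: measurable_funD.
- by apply: integrable_realZ; exact: integrable_realD.
- move=> x _; rewrite ger0_norm ?sqr_ge0//.
  by have := sqr_ge0 (f x - g x); rewrite sqrrB sqrrD; lra.
Qed.

(** Used with [c] a constant, and with [c] a coordinate function, which is bounded on a bounded
    domain. *)
Lemma sq_integrable_bM f (c : T -> R) M : measurable_fun D c ->
  (forall x, D x -> `|c x| <= M) -> sq_integrable f ->
  sq_integrable (fun x => c x * f x).
Proof.
move=> mc cM [mf sf]; split; first exact: measurable_funM.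
apply: (@le_integrable_real _ (fun x => M ^+ 2 * f x ^+ 2)).
- by apply: measurable_funX; exact: measurable_funM.
- exact: integrable_realZ.
- move=> x Dx; rewrite ger0_norm ?sqr_ge0// exprMn ler_wpM2r ?sqr_ge0//.
  by rewrite -[leLHS]real_normK ?num_real// ler_sqr ?nnegrE ?(le_trans _ (cM x Dx))// cM.
Qed.

Lemma sq_integrableZ k f : sq_integrable f -> sq_integrable (fun x => k * f x).
Proof. exact: (@sq_integrable_bM _ (cst k) `|k|). Qed.

Lemma sq_integrableB f g : sq_integrable f -> sq_integrable g ->
  sq_integrable (fun x => f x - g x).
Proof.
move=> sf sg; under eq_fun do rewrite -mulN1r.
by apply: sq_integrableD => //; exact: sq_integrableZ.
Qed.

Lemma sq_integrable_mxB m k (A B : T -> 'M[R]_(m, k)) i j :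
  sq_integrable (fun x => A x i j) -> sq_integrable (fun x => B x i j) ->
  sq_integrable (fun x => (A x - B x) i j).
Proof.
move=> sA sB; rewrite (_ : (fun x => _) = (fun x => A x i j - B x i j)).
  exact: sq_integrableB.
by apply/funext => x; rewrite !mxE.
Qed.

Lemma sq_integrable_sum I (s : seq I) (F : I -> T -> R) :
  (forall i, sq_integrable (F i)) ->
  sq_integrable (fun x => \sum_(i <- s) F i x).
Proof.
move=> sF; elim: s => [|i s IH].
  under eq_fun do rewrite big_nil.
  by split=> //; under eq_fun do rewrite expr0n; exact: integrable0.
by under eq_fun do rewrite big_cons; exact: sq_integrableD.
Qed.

Lemma integrable_real_sum I (s : seq I) (F : I -> T -> R) :
  (forall i, mu.-integrable D (EFin \o F i)) ->
  mu.-integrable D (EFin \o (fun x => \sum_(i <- s) F i x)).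
Proof.
move=> iF.
apply: eq_integrable (integrable_sum mD (P := predT) s (fun i _ => iF i)) => //.
by move=> x _ /=; rewrite -sumEFin.
Qed.

Lemma Rintegral_sum I (s : seq I) (F : I -> T -> R) :
  (forall i, mu.-integrable D (EFin \o F i)) ->
  \int[mu]_(x in D) (\sum_(i <- s) F i x) =
  \sum_(i <- s) \int[mu]_(x in D) F i x.
Proof.
move=> iF; elim: s => [|i s IH].
  rewrite big_nil; under eq_Rintegral do rewrite big_nil.
  by rewrite Rintegral_cst// mul0r.
rewrite big_cons -IH -RintegralD//; last exact: integrable_real_sum.
by apply: eq_Rintegral => x _; rewrite big_cons.
Qed.

Lemma ipC f g : ip f g = ip g f.
Proof. by congr fine; apply: eq_integral => x _; rewrite mulrC. Qed.

Lemma ipDl f g h : sq_integrable f -> sq_integrable g -> sq_integrable h ->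
  ip (fun x => f x + g x) h = ip f h + ip g h.
Proof.
move=> sf sg sh; rewrite /ip -RintegralD//; try exact: integrable_sqM.
by apply: eq_Rintegral => x _; rewrite mulrDl.
Qed.

Lemma ipZl k f g : sq_integrable f -> sq_integrable g ->
  ip (fun x => k * f x) g = k * ip f g.
Proof.
move=> sf sg; rewrite /ip -RintegralZl//; last exact: integrable_sqM.
by apply: eq_Rintegral => x _; rewrite mulrA.
Qed.

Lemma ipBl f g h : sq_integrable f -> sq_integrable g -> sq_integrable h ->
  ip (fun x => f x - g x) h = ip f h - ip g h.
Proof.
move=> sf sg sh; rewrite /ip -RintegralB//; try exact: integrable_sqM.
by apply: eq_Rintegral => x _; rewrite mulrBl.
Qed.

Lemma ipBr f g h : sq_integrable f -> sq_integrable g -> sq_integrable h ->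
  ip h (fun x => f x - g x) = ip h f - ip h g.
Proof. by move=> *; rewrite ipC ipBl// (ipC f) (ipC g). Qed.

Lemma ip_suml I (s : seq I) (F : I -> T -> R) g :
  (forall i, sq_integrable (F i)) -> sq_integrable g ->
  ip (fun x => \sum_(i <- s) F i x) g = \sum_(i <- s) ip (F i) g.
Proof.
move=> sF sg; rewrite /ip -Rintegral_sum; last by move=> i; exact: integrable_sqM.
by apply: eq_Rintegral => x _; rewrite mulr_suml.
Qed.

Lemma ip_ge0 f : 0 <= ip f f.
Proof. by apply: Rintegral_ge0 => x _; rewrite -expr2 sqr_ge0. Qed.

(** The squared norm of [t f + g] is a nonnegative quadratic in [t]; its discriminant gives the
    bound. *)
Lemma cauchy_schwarz f g : sq_integrable f -> sq_integrable g ->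
  `|ip f g| <= l2norm f * l2norm g.
Proof.
move=> sf sg.
have H t : 0 <= t ^+ 2 * ip f f + 2 * t * ip f g + ip g g.
  have := ip_ge0 (fun x => t * f x + g x).
  have st := sq_integrableZ t sf; have std := sq_integrableD st sg.
  rewrite ipDl// ipZl// ![ip _ (fun x => _ + _)]ipC !ipDl// !ipZl// (ipC g f).
  by lra.
rewrite /l2norm -sqrtrM ?ip_ge0// -sqrtr_sqr ler_wsqrtr//.
exact: discriminant_le (ip_ge0 f) H.
Qed.

(** Completing the square pointwise: the two integrands differ by [k (f - g / (2 k))^2]. The free
    weight [k] is what later allows a term to be absorbed exactly. *)
Lemma ip_young f g k : 0 < k -> sq_integrable f -> sq_integrable g ->
  ip f g <= k * ip f f + (4 * k)^-1 * ip g g.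
Proof.
move=> k0 sf sg; rewrite -!ipZl//; try exact: sq_integrableZ.
rewrite /ip -RintegralD//; try by apply: integrable_sqM => //; exact: sq_integrableZ.
apply: le_Rintegral => //; first exact: integrable_sqM.
  by apply: integrable_realD; apply: integrable_sqM => //; exact: sq_integrableZ.
move=> x _; rewrite -subr_ge0.
have -> : k * f x * f x + (4 * k)^-1 * g x * g x - f x * g x =
  k * (f x - (2 * k)^-1 * g x) ^+ 2.
  by field; rewrite gt_eqF.
by rewrite mulr_ge0 ?sqr_ge0// ltW.
Qed.

(** Parallelogram law: the gap between the two sides is the squared norm of [f + g]. *)
Lemma ip_sqrB_le f g : sq_integrable f -> sq_integrable g ->
  ip (fun x => f x - g x) (fun x => f x - g x) <= 2 * (ip f f + ip g g).
Proof.
move=> sf sg; have := ip_ge0 (fun x => f x + g x).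
have sD := sq_integrableD sf sg; have sB := sq_integrableB sf sg.
rewrite ipBl// !ipBr// (ipC g f) ipDl// (ipC f) (ipC g) !ipDl// (ipC g f).
by lra.
Qed.

Lemma ip_mxB_le m k (A B : T -> 'M[R]_(m, k)) i j :
  sq_integrable (fun x => A x i j) -> sq_integrable (fun x => B x i j) ->
  ip (fun x => (A x - B x) i j) (fun x => (A x - B x) i j) <=
  2 * (ip (fun x => A x i j) (fun x => A x i j) +
       ip (fun x => B x i j) (fun x => B x i j)).
Proof.
move=> sA sB; rewrite (_ : (fun x => _) = (fun x => A x i j - B x i j)).
  exact: ip_sqrB_le.
by apply/funext => x; rewrite !mxE.
Qed.

End square_integrable.

(** * Borel sets and bounded sets of R^n *)

Section borel_rV.
Context {R : realType}.

(** Balls are those of the max norm, hence finite intersections of coordinate preimages of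
    intervals, or empty when the radius is not positive. *)
Lemma measurable_ball_rV n (x : 'rV[R]_n) (e : R) : measurable (ball x e).
Proof.
have [e0|e0] := ltP 0 e; last first.
  rewrite (_ : ball x e = set0)// -subset0 => y [e0' _].
  by move: e0; rewrite leNgt e0'.
rewrite (_ : ball x e = \bigcap_(i in [set: 'I_n])
    ((fun y : 'rV[R]_n => y ord0 i) @^-1` (ball (x ord0 i) e))).
  apply: fin_bigcap_measurable => // i _.
  rewrite -[X in measurable X]setTI; apply: measurable_coord => //.
  by apply: open_measurable; apply: ball_open.
apply/seteqP; split => [y [_ H] i _|y H]; first exact: H.
by apply: conj => // i j; rewrite (ord1 i); exact: H.
Qed.

(** The sigma-algebra is generated by the coordinates, so second countability is needed: [U] is the
    countable union of the balls with rational centre and radius that it contains. *)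
Lemma open_measurable_rV n (U : set 'rV[R]_n) : open U -> measurable U.
Proof.
move=> oU.
pose B (q : 'rV[rat]_n) (r : rat) := ball (map_mx ratr q : 'rV[R]_n) (ratr r : R).
rewrite (_ : U = \bigcup_qr
    if `[< B qr.1 qr.2 `<=` U >] then B qr.1 qr.2 else set0); last first.
  apply/seteqP; split => [x Ux|x [qr _]]; last first.
    by case: asboolP => // + Bx; exact.
  have /nbhs_ballP[e e0 xeU] : nbhs x U by exact: open_nbhs_nbhs.
  (* With [r < e / 2], any ball of radius [r] containing [x] lies inside [ball x e]. *)
  have [r] := @rat_in_itvoo R 0 (e / 2) (divr_gt0 e0 (ltr0n _ 2)).
  rewrite in_itv/= => /andP[r0 re].
  have /choice[q xq] (i : 'I_n) : exists q : rat, `|ratr q - x ord0 i| < ratr r.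
    have [q] : exists q : rat, ratr q \in `](x ord0 i - ratr r), (x ord0 i + ratr r)[.
      by apply: rat_in_itvoo; rewrite ltrBlDr -addrA ltrDl addr_gt0.
    rewrite in_itv/= => /andP[? ?]; exists q.
    by rewrite ltr_distlC; apply/andP; split; lra.
  have Bx : B (\row_i q i) r x.
    by apply: conj => // i j; rewrite !mxE (ord1 i); exact: xq.
  exists (\row_i q i, r) => //=; case: asboolP => //; case=> y By; apply: xeU.
  apply: (@le_ball _ _ x (ratr r + ratr r)); first by lra.
  exact: ball_triangle (ball_sym Bx) By.
apply: countable_bigcupT_measurable => [|qr]; first exact: countableP.
by case: ifP => // _; exact: measurable_ball_rV.
Qed.

Lemma continuous_measurable_rV n (f : 'rV[R]_n -> R) :
  continuous f -> measurable_fun setT f.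
Proof.
move=> /continuousP cf; apply: (measurability _ (RGenOpens.measurableE R)).
move=> _ [_ [a [b ->] <-]]; rewrite setTI.
by apply: open_measurable_rV; exact/cf/interval_open.
Qed.

Let box n (M : R) : set 'rV[R]_n := [set x | forall i, `|x ord0 i| <= M].

(** Induction along the construction of [lebesgue_rV]: the cube of dimension [n + 1] pulls back
    through [cons_rV] to an interval times the cube of dimension [n]. *)
Let lebesgue_box_lty n (M : R) :
  measurable (@box n M) /\
  (lebesgue_rV n (@box n M) < +oo)%E.
Proof.
have mbox k : measurable (@box k M).
  rewrite (_ : @box k M = \bigcap_(i in [set: 'I_k])
      ((fun y : 'rV[R]_k => y ord0 i) @^-1` [set t | `|t| <= M])).
    apply: fin_bigcap_measurable => // i _.
    rewrite -[X in measurable X]setTI; apply: measurable_coord => //.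
    rewrite (_ : mkset _ = `[-M, M]%classic)//.
    by apply/seteqP; split => t /=; rewrite in_itv/= ler_norml.
  by apply/seteqP; split => x H i; [move=> _|]; exact: H.
split=> //; elim: n => [|n IH].
  by rewrite /lebesgue_rV/= /lebesgue_rV0 diracE ltry.
rewrite /= /lebesgue_rV_succ /pushforward.
rewrite (_ : _ @^-1` _ = `[-M, M]%classic `*`
    @box n M); last first.
  apply/seteqP; split => [[a y]|[a y] [/= aM yM] i] /=.
    rewrite /cons_rV/= => H; split => [|i].
      rewrite in_itv/= -ler_norml.
      have := H (lshift n ord0 : 'I_(1 + n)).
      by rewrite [X in X ord0]/= [X in `|X|]row_mxEl mxE eqxx.
    by have := H (rshift 1 i); rewrite [X in `|X|]row_mxEr.
  rewrite /cons_rV; case: (@split_ordP 1 n i) => j ->.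
    rewrite [X in `|X|]row_mxEl (ord1 j) mxE eqxx/= ler_norml.
    by move: aM; rewrite in_itv.
  by rewrite [X in `|X|]row_mxEr.
rewrite product_measure1E//; last exact: mbox.
rewrite lte_mul_pinfty// ge0_fin_numE//.
rewrite [ltLHS](@lebesgue_measure_itv R `[-M, M])/=.
by case: ifP => // _; rewrite -EFinB ltry.
Qed.

Lemma bounded_set_coord n (A : set 'rV[R]_n) : bounded_set A ->
  exists2 M : R, 0 < M & forall x, A x -> forall i, `|x ord0 i| <= M.
Proof.
move=> [M0 [_ /(_ (M0 + 1))]]; rewrite ltrDl ltr01 => /(_ isT).
(* The maximum with 1 makes the bound positive, as [poincare] requires. *)
set M := M0 + 1 => AM; exists (Num.max M 1).
  by rewrite lt_max ltr01 orbT.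
move=> x /AM xM i; rewrite le_max; apply/orP; left; apply: le_trans xM.
by rewrite [leRHS]/Num.norm /= mx_normrE; apply: (le_bigmax _ _ (ord0, i)).
Qed.

Lemma bounded_lebesgue_lty n (A : set 'rV[R]_n) : bounded_set A ->
  measurable A -> (lebesgue_rV n A < +oo)%E.
Proof.
move=> /bounded_set_coord[M _ AM] mA; have [mB Boo] := lebesgue_box_lty n M.
by apply: le_lt_trans Boo; rewrite le_measure// ?inE// => x /AM.
Qed.

End borel_rV.

(** * Symmetry of second derivatives *)

Section schwarz.
Context {R : realType} {V : normedModType R}.
Implicit Types (f : V -> R) (a b v x : V).

(** Chain rule along a line, which brings directional derivatives within reach of the one-variable
    mean value theorem. *)
Lemma is_derive_line f x v (s : R) : differentiable f (x + s *: v) ->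
  is_derive s 1 (fun t : R => f (x + t *: v)) ('D_v f (x + s *: v)).
Proof.
move=> df; pose l (t : R) := x + t *: v.
have dl : is_diff s l (fun t => t *: v).
  rewrite -[X in is_diff _ _ X]add0r; exact: is_diffD.
have dfl : differentiable (f \o l) s by apply: differentiable_comp.
apply: DeriveDef; first exact: diff_derivable.
rewrite deriveE// (_ : (fun _ => _) = f \o l)// diff_comp//=.
by rewrite [in X in 'd f _ X]diff_val scale1r deriveE.
Qed.

(** The mean value theorem is used twice: along [a] for the increment of [f] over [h *: b], then
    along [b] for ['D_a f]. *)
Lemma second_difference f a b x (h : R) : 0 < h ->
  (forall y, differentiable f y) -> (forall y, differentiable ('D_a f) y) ->
  exists s t, [/\ s \in `]0, h[, t \in `]0, h[ &
    f (x + h *: b + h *: a) - f (x + h *: a) - (f (x + h *: b) - f x) =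
    'D_b ('D_a f) (x + s *: a + t *: b) * h * h].
Proof.
move=> h0 df daf.
pose G (s : R) := f (x + h *: b + s *: a) - f (x + s *: a).
pose dG (s : R) := 'D_a f (x + h *: b + s *: a) - 'D_a f (x + s *: a).
have GdG (s : R) : is_derive s 1 G (dG s).
  by apply: is_deriveB; exact: is_derive_line.
have contG (g dg : R -> R) : (forall s : R, is_derive s 1 g (dg s)) ->
    {within `[0, h], continuous g}.
  move=> gdg; apply: continuous_subspaceT => s.
  by apply/differentiable_continuous/derivable1_diffP; case: (gdg s).
have [s sh Gs] := MVT h0 (fun s _ => GdG s) (contG _ _ GdG).
pose K (t : R) := 'D_a f (x + s *: a + t *: b).
have KdK (t : R) : is_derive t 1 K ('D_b ('D_a f) (x + s *: a + t *: b)).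
  exact: is_derive_line.
have [t th Kt] := MVT h0 (fun t _ => KdK t) (contG _ _ KdK).
exists s, t; split => //; move: Gs Kt.
rewrite /G /K /dG !subr0 !scale0r !addr0 => ->.
by rewrite (addrAC x) => ->.
Qed.

(** The second difference is symmetric in [a] and [b], so the two mixed derivatives agree at some
    pair of points close to [x]; continuity at [x] carries the equality to [x]. *)
Lemma derive_comm f a b x :
  (forall y, differentiable f y) ->
  (forall y, differentiable ('D_a f) y) ->
  (forall y, differentiable ('D_b f) y) ->
  {for x, continuous ('D_b ('D_a f))} ->
  {for x, continuous ('D_a ('D_b f))} ->
  'D_b ('D_a f) x = 'D_a ('D_b f) x.
Proof.
move=> df daf dbf cba cab; apply/eqP; rewrite -subr_eq0 -normr_le0.
apply/ler_addgt0Pl => e e0; rewrite addr0.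
have dist3 (p q u v : R) : u = v -> `|p - u| < e / 2 -> `|q - v| < e / 2 ->
    `|p - q| <= e.
  move=> -> pv qv; rewrite (splitr e) (le_trans (ler_distD v _ _))//.
  by apply: ltW; rewrite (ltrD pv)// distrC.
have e20 : 0 < e / 2 by rewrite divr_gt0.
move/cvgr_dist_lt : cba => /(_ _ e20) /nbhs_ballP[d1 d10 Hba].
move/cvgr_dist_lt : cab => /(_ _ e20) /nbhs_ballP[d2 d20 Hab].
(* For [s], [t] below [h] the displacement [s a + t b] has norm less than [h * N], the smaller of
   the two radii; the added 1 keeps [N] positive when [a] and [b] vanish. *)
pose N := `|a| + `|b| + 1.
have N0 : 0 < N by rewrite ltr_wpDl// addr_ge0.
pose h := Num.min d1 d2 / N.
have h0 : 0 < h by rewrite divr_gt0// lt_min d10 d20.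
have near_x (s t : R) : s \in `]0, h[ -> t \in `]0, h[ ->
    ball x (Num.min d1 d2) (x + s *: a + t *: b).
  rewrite !in_itv/= => /andP[s0 sh] /andP[t0 th].
  rewrite -ball_normE/= opprD opprD addrA addrA subrr add0r -opprD normrN.
  rewrite (le_lt_trans (ler_normD _ _))// !normrZ !gtr0_norm//.
  have -> : Num.min d1 d2 = h * N by rewrite /h divfK// gt_eqF.
  rewrite /N !mulrDr mulr1.
  by rewrite -addrA ler_ltD//;
   [rewrite ler_wpM2r//; exact/ltW | rewrite ltr_pwDr// ler_wpM2r//; exact/ltW].
have [s [t [sh th E1]]] := second_difference b x h0 df daf.
have [t' [s' [th' sh' E2]]] := second_difference a x h0 df dbf.
(* Both sides times [h * h] are the same second difference, with its two middle values exchanged. *)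
have E : 'D_b ('D_a f) (x + s *: a + t *: b) =
         'D_a ('D_b f) (x + t' *: b + s' *: a).
  apply: (mulIf (lt0r_neq0 h0)); apply: (mulIf (lt0r_neq0 h0)).
  have swap (p q r u : R) : p - q - (r - u) = p - r - (q - u) by ring.
  apply: etrans (esym E1) (etrans _ E2).
  by rewrite [LHS]swap (addrAC x (h *: b)).
have H1 : `|'D_b ('D_a f) x - 'D_b ('D_a f) (x + s *: a + t *: b)| < e / 2.
  apply: Hba; apply: le_ball (near_x _ _ sh th).
  by rewrite ge_min lexx.
have H2 : `|'D_a ('D_b f) x - 'D_a ('D_b f) (x + t' *: b + s' *: a)| < e / 2.
  apply: Hab; rewrite addrAC; apply: le_ball (near_x _ _ sh' th').
  by rewrite ge_min lexx orbT.
exact: dist3 E H1 H2.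
Qed.

End schwarz.

(** * Test functions *)

Section test_functions.
Context {R : realType} {n : nat}.
Implicit Types (Om : set 'rV[R]_n) (h : 'rV[R]_n -> R).

Lemma smooth_differentiable h x : smooth h -> differentiable h x.
Proof. by move=> /(_ [::] x). Qed.

Lemma smooth_continuous h : smooth h -> continuous h.
Proof. by move=> sh x; apply/differentiable_continuous/smooth_differentiable. Qed.

Lemma smooth_partial j h : smooth h -> smooth (partial j h).
Proof. by move=> sh js x; have := sh (rcons js j) x; rewrite foldr_rcons. Qed.

(** Coinduction: a family of differentiable functions stable under partial derivatives is smooth,
    and no formula for iterated derivatives has to be found. *)
Lemma smooth_coind (P : ('rV[R]_n -> R) -> Prop) :
  (forall h, P h -> (forall x, differentiable h x) /\ forall j, P (partial j h)) ->
  forall h, P h -> smooth h.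
Proof.
move=> HP h Ph js.
suff /HP[] : P (foldr (@partial R n) h js) by [].
by elim: js => //= j js /HP[_]; exact.
Qed.

Lemma smooth_linear (c : R) h1 h2 : smooth h1 -> smooth h2 ->
  smooth (fun x => c * h1 x + h2 x).
Proof.
move=> sh1 sh2; pose P g := exists h1 h2,
  [/\ smooth h1, smooth h2 & g = fun x => c * h1 x + h2 x].
apply: (@smooth_coind P); last by exists h1, h2.
move=> _ [g1 [g2 [s1 s2 ->]]].
have d1 x := smooth_differentiable x s1; have d2 x := smooth_differentiable x s2.
split=> [x|j]; first by apply: differentiableD => //; exact: differentiableZ.
exists (partial j g1), (partial j g2); split; try exact: smooth_partial.
apply/funext => x; rewrite /partial.
have e1 : derivable g1 x (delta_mx ord0 j) by exact: diff_derivable.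
have e2 : derivable g2 x (delta_mx ord0 j) by exact: diff_derivable.
have -> : (fun y => c * g1 y + g2 y) = c *: g1 + g2 by [].
by rewrite deriveD ?deriveZ//; exact: derivableZ.
Qed.

Lemma derive_coord (k : 'I_n) (x v : 'rV[R]_n) :
  'D_v (fun y : 'rV[R]_n => y ord0 k : R) x = v ord0 k.
Proof.
(* Packaged as a linear map, the coordinate is its own differential. *)
have @f : {linear 'rV[R]_n -> R}.
  by exists (fun N : 'rV[R]_n => N ord0 k); do 2![eexists]; do ?[constructor];
     rewrite ?mxE// => ? *; rewrite ?mxE//; move=> ?; rewrite !mxE.
rewrite (_ : (fun _ => _) = f)// deriveE; last exact: differentiable_coord.
by rewrite diff_lin//; exact: coord_continuous.
Qed.

Lemma partial_coordM j (k : 'I_n) h x : differentiable h x ->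
  partial j (fun y : 'rV[R]_n => y ord0 k * h y) x =
  (k == j)%:R * h x + x ord0 k * partial j h x.
Proof.
move=> dh; pose e : 'rV[R]_n := delta_mx ord0 j.
have e1 : derivable (fun y : 'rV[R]_n => y ord0 k : R) x e.
  exact/diff_derivable/differentiable_coord.
have e2 : derivable h x e by exact: diff_derivable.
rewrite /partial -/e (deriveM e1 e2) derive_coord /e mxE eqxx/= (eq_sym k).
by rewrite addrC; congr (_ + _); rewrite mulrC.
Qed.

Lemma smooth_coordM (k : 'I_n) h :
  smooth h -> smooth (fun x : 'rV[R]_n => x ord0 k * h x).
Proof.
(* The second summand is needed for stability: differentiating [x_k h1] in direction [k] leaves an
   extra [h1]. *)
move=> sh; pose P g := exists h1 h2,
  [/\ smooth h1, smooth h2 & g = fun x : 'rV[R]_n => x ord0 k * h1 x + h2 x].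
have s0 : smooth (fun _ : 'rV[R]_n => 0 : R).
  apply: (@smooth_coind (fun h => h = fun=> 0)) => // _ ->; split => // j.
  by apply/funext => x; exact: derive_cst.
apply: (@smooth_coind P); last first.
  by exists h, (fun=> 0); split => //; apply/funext => x; rewrite addr0.
move=> _ [g1 [g2 [s1 s2 ->]]].
have d1 x := smooth_differentiable x s1; have d2 x := smooth_differentiable x s2.
have dM x : differentiable (fun x : 'rV[R]_n => x ord0 k * g1 x) x.
  by apply: differentiableM => //; exact: differentiable_coord.
split=> [x|j]; first by apply: differentiableD.
exists (partial j g1), (fun x => (k == j)%:R * g1 x + partial j g2 x).
split; [exact: smooth_partial| |].
  by apply: smooth_linear => //; exact: smooth_partial.
apply/funext => x.
rewrite (_ : (fun y : 'rV[R]_n => _) = (fun y : 'rV[R]_n => y ord0 k * g1 y) + g2)//.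
rewrite /partial deriveD; try exact: diff_derivable.
by rewrite -!/(partial _ _ _) partial_coordM// addrA; congr (_ + _); exact: addrC.
Qed.

Lemma partial_comm i j h x : smooth h ->
  partial i (partial j h) x = partial j (partial i h) x.
Proof.
move=> sh; apply: derive_comm => [y|y|y||].
- exact: smooth_differentiable.
- exact/smooth_differentiable/smooth_partial.
- exact/smooth_differentiable/smooth_partial.
- exact/smooth_continuous/smooth_partial/smooth_partial.
- exact/smooth_continuous/smooth_partial/smooth_partial.
Qed.

(** The second hypothesis says that [g] depends locally on [h], which forces the support of [g] into
    that of [h]. It serves both for partial derivatives and for products with a coordinate. *)
Lemma test_functionS Om h g : smooth g ->
  (forall x, (\forall y \near x, h y = 0) -> g x = 0) ->
  test_function Om h -> test_function Om g.
Proof.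
move=> sg hg [sh ch hOm].
have gh : supp g `<=` supp h.
  rewrite [supp h](closure_id _).1; last exact: closed_closure.
  apply: closure_subset => x /= gx; apply: contrapT => hx.
  move/eqP: gx; apply; apply: hg.
  have : nbhs x (~` supp h).
    by apply: open_nbhs_nbhs; split => //; exact/closed_openC/closed_closure.
  apply: filterS => y hy; apply: contrapT => /eqP hy0; apply: hy.
  exact: subset_closure.
split => //; last exact: subset_trans hOm.
by apply: subclosed_compact ch gh; exact: closed_closure.
Qed.

Lemma partialB j h g x : differentiable h x -> differentiable g x ->
  partial j (fun y => h y - g y) x = partial j h x - partial j g x.
Proof.
move=> dh dg; rewrite /partial.
have e1 : derivable h x (delta_mx ord0 j) by exact: diff_derivable.
have e2 : derivable g x (delta_mx ord0 j) by exact: diff_derivable.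
exact: (deriveB e1 e2).
Qed.

Lemma test_functionB Om h g : test_function Om h -> test_function Om g ->
  test_function Om (fun x => h x - g x).
Proof.
move=> [sh ch hOm] [sg cg gOm].
have hgU : supp (fun x => h x - g x) `<=` supp h `|` supp g.
  have /closure_id -> : closed (supp h `|` supp g).
    by apply: closedU; exact: closed_closure.
  apply: closure_subset => x /= hgx; have [hx0|hx] := eqVneq (h x) 0.
    right; apply: subset_closure => /=.
    by apply: contraNneq hgx => gx0; rewrite hx0 gx0 subrr.
  by left; exact: subset_closure.
split.
- under eq_fun do rewrite addrC -mulN1r; exact: smooth_linear.
- by apply: subclosed_compact (compactU ch cg) hgU; exact: closed_closure.
- by apply: (subset_trans hgU) => x [/hOm|/gOm].
Qed.

Lemma test_function_partial Om j h :
  test_function Om h -> test_function Om (partial j h).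
Proof.
move=> th; apply: test_functionS (th); first by case: th => sh _ _; exact: smooth_partial.
by move=> x hx; rewrite /partial (@near_eq_derive _ _ _ h (cst 0)) ?derive_cst.
Qed.

Lemma test_function_coordM Om (k : 'I_n) h :
  test_function Om h -> test_function Om (fun x : 'rV[R]_n => x ord0 k * h x).
Proof.
move=> th; apply: test_functionS (th); first by case: th => sh _ _; exact: smooth_coordM.
by move=> x /nbhs_singleton ->; rewrite mulr0.
Qed.

Lemma test_function_bounded Om h : test_function Om h ->
  exists M, forall x, `|h x| <= M.
Proof.
move=> [sh ch _].
have /compact_bounded[M [_ /(_ (M + 1))]] : compact (h @` supp h).
  apply: continuous_compact => //; apply: continuous_subspaceT.
  exact: smooth_continuous.
rewrite ltrDl ltr01 => /(_ isT) hM.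
exists (Num.max (M + 1) 0) => x.
have [->|hx] := eqVneq (h x) 0; first by rewrite normr0 le_max lexx orbT.
by rewrite le_max hM//; exists x => //; exact: subset_closure.
Qed.

(** A test function is bounded and continuous, and [Om] has finite measure. *)
Lemma test_function_L2 Om h : open Om -> bounded_set Om ->
  test_function Om h -> L2 Om h.
Proof.
move=> oOm bOm th; have mOm := open_measurable_rV oOm.
have mh : measurable_fun Om h.
  apply: measurable_funTS; apply: continuous_measurable_rV.
  by case: th => sh _ _; exact: smooth_continuous.
have [M hM] := test_function_bounded th; split => //.
apply: (@le_integrable_real _ _ _ (lebesgue_rV n) Om mOm _ (fun=> M ^+ 2)).
- exact: measurable_funX.
- apply/integrableP; split; first exact: measurable_cst.
  under eq_integral do rewrite /= ger0_norm ?sqr_ge0//.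
  by rewrite integral_cst// lte_mul_pinfty ?lee_fin ?sqr_ge0// bounded_lebesgue_lty.
- move=> x _; rewrite ger0_norm ?sqr_ge0// -real_normK ?num_real//.
  by rewrite ler_sqr ?nnegrE// (le_trans _ (hM x)).
Qed.

End test_functions.

(** * Korn and Poincare inequalities *)

Section frobenius.
Context {R : realType} {n : nat}.
Implicit Types A B : 'M[R]_n.

Lemma frobE A B : frob A B = \sum_i \sum_j A i j * B i j.
Proof.
rewrite /frob /mxtrace; apply: eq_bigr => i _; rewrite mxE.
by apply: eq_bigr => j _; rewrite mxE.
Qed.

Lemma frobC A B : frob A B = frob B A.
Proof.
by rewrite !frobE; do 2!apply: eq_bigr => ? _; rewrite mulrC.
Qed.

Lemma frob_ge0 A : 0 <= frob A A.
Proof. by rewrite frobE; do 2!apply: sumr_ge0 => ? _; rewrite -expr2 sqr_ge0. Qed.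

Lemma frobDl A B C : frob (A + B) C = frob A C + frob B C.
Proof. by rewrite /frob mulmxDl mxtraceD. Qed.

Lemma frobZl k A C : frob (k *: A) C = k * frob A C.
Proof. by rewrite /frob -scalemxAl mxtraceZ. Qed.

Lemma frobBl A B C : frob (A - B) C = frob A C - frob B C.
Proof. by rewrite -scaleN1r frobDl frobZl mulN1r. Qed.

Lemma frobBr A B C : frob C (A - B) = frob C A - frob C B.
Proof. by rewrite frobC frobBl !(frobC C). Qed.

Lemma sqr_frobnorm A : frobnorm A ^+ 2 = frob A A.
Proof. by rewrite sqr_sqrtr// frob_ge0. Qed.

Lemma frob_le_norm A B : frob A B <= frobnorm A * frobnorm B.
Proof.
rewrite /frobnorm -sqrtrM ?frob_ge0//; apply: (le_trans (ler_norm _)).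
rewrite -sqrtr_sqr ler_wsqrtr//; apply: discriminant_le => [|t].
  exact: frob_ge0.
have := frob_ge0 (t *: A + B).
rewrite frobDl frobZl ![frob _ (_ + _)]frobC !frobDl !frobZl (frobC B A).
by lra.
Qed.

(** Write [a], [b] for the norms of [A], [B] and [p], [q] for the two maxima. Since
    [t / max(g, beta t)] is nondecreasing, [(a/p - b/q)(a - b)] is nonnegative, and the claimed
    quantity exceeds it by [(ab - A:B)(1/p + 1/q)], nonnegative by Cauchy-Schwarz. *)
Lemma frob_monotone (g beta : R) A B : 0 < g -> 0 < beta ->
  0 <= frob A (A - B) / Num.max g (beta * frobnorm A) -
       frob B (A - B) / Num.max g (beta * frobnorm B).
Proof.
move=> g0 b0; rewrite !frobBr -!sqr_frobnorm (frobC B A).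
have a0 : 0 <= frobnorm A by exact: sqrtr_ge0.
have c0 : 0 <= frobnorm B by exact: sqrtr_ge0.
have := frob_le_norm A B; move: (frob A B) a0 c0.
move: (frobnorm A) (frobnorm B) => a b s a0 b0' sab.
have mx0 t : 0 < Num.max g (beta * t) by rewrite lt_max g0.
have mono x y : 0 <= x -> x <= y ->
    x / Num.max g (beta * x) <= y / Num.max g (beta * y).
  move=> x0 xy; rewrite ler_pdivrMr// mulrAC ler_pdivlMr//.
  have y0 := le_trans x0 xy.
  rewrite maxr_pMr// ge_max; apply/andP; split.
    by apply: ler_pM => //; [exact: ltW|rewrite le_max lexx].
  by rewrite mulrCA (mulrA beta) (mulrC (beta * x)) ler_wpM2l// le_max lexx orbT.
have key : 0 <= (a / Num.max g (beta * a) - b / Num.max g (beta * b)) * (a - b).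
  have [ab|/ltW ba] := leP a b.
    by rewrite mulr_le0// subr_le0// mono.
  by rewrite mulr_ge0// subr_ge0// mono.
apply: le_trans key _; rewrite -subr_ge0.
set p := Num.max _ _; set q := Num.max _ _.
have -> : (a ^+ 2 - s) / p - (s - b ^+ 2) / q - (a / p - b / q) * (a - b) =
  (a * b - s) * (p^-1 + q^-1) by ring.
by rewrite mulr_ge0 ?subr_ge0// addr_ge0// invr_ge0 ltW// mx0.
Qed.

End frobenius.

(** * Estimates in [H_0^1] by approximation with test functions *)

Section sobolev_estimates.
Context {R : realType} {n : nat}.
Variables (Om : set 'rV[R]_n) (Om_open : open Om) (Om_bounded : bounded_set Om).

Let mOm : measurable Om. Proof. exact: open_measurable_rV. Qed.

Local Notation ipOm := (ip (lebesgue_rV n) Om).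
Local Notation normOm := (l2norm (lebesgue_rV n) Om).
Local Notation component v i := (fun x => v x ord0 i).
Local Notation entry A i j := (fun x => A x i j).

Let sq_test h : test_function Om h -> sq_integrable (lebesgue_rV n) Om h.
Proof. exact: test_function_L2. Qed.

Lemma L2_jac (phi : 'rV[R]_n -> 'rV[R]_n) i j :
  (forall i, test_function Om (component phi i)) -> L2 Om (entry (jac phi) i j).
Proof.
move=> tphi; rewrite (_ : (fun x => _) = partial j (component phi i)).
  exact/sq_test/test_function_partial.
by apply/funext => x; rewrite mxE.
Qed.

(** Square-integrability allows the single integral to be split, so that the norm can be handled
    component by component through [ip]. *)
Lemma sqr_H1norm (w : 'rV[R]_n -> 'rV[R]_n) (Dw : 'rV[R]_n -> 'M[R]_n) :
  (forall i, L2 Om (component w i)) -> (forall i j, L2 Om (entry Dw i j)) ->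
  H1norm Om w Dw ^+ 2 = \sum_i ipOm (component w i) (component w i) +
    \sum_i \sum_j ipOm (entry Dw i j) (entry Dw i j).
Proof.
move=> sw sD; rewrite sqr_sqrtr; last first.
  apply: Rintegral_ge0 => x _; rewrite addr_ge0//; apply: sumr_ge0 => i _.
    exact: sqr_ge0.
  by apply: sumr_ge0 => j _; exact: sqr_ge0.
have iw i := integrable_sqM mOm (sw i) (sw i).
have iD i j := integrable_sqM mOm (sD i j) (sD i j).
rewrite (_ : \sum_i \sum_j ipOm _ _ =
  \int[lebesgue_rV n]_(x in Om) \sum_i \sum_j (Dw x i j * Dw x i j)); last first.
  rewrite Rintegral_sum//; last by move=> i; exact: integrable_real_sum.
  by apply: eq_bigr => i _; rewrite Rintegral_sum.
rewrite -Rintegral_sum//  -RintegralD//.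
- exact: integrable_real_sum.
- by apply: integrable_real_sum => // i; exact: integrable_real_sum.
Qed.

(** Replaces the triangle inequality for [H1norm]; it is [ip_sqrB_le] summed over components. *)
Lemma sqr_H1normB_le (v w : 'rV[R]_n -> 'rV[R]_n) (Dv Dw : 'rV[R]_n -> 'M[R]_n) :
  (forall i, L2 Om (component v i)) -> (forall i, L2 Om (component w i)) ->
  (forall i j, L2 Om (entry Dv i j)) -> (forall i j, L2 Om (entry Dw i j)) ->
  H1norm Om (fun x => v x - w x) (fun x => Dv x - Dw x) ^+ 2 <=
  2 * (H1norm Om v Dv ^+ 2 + H1norm Om w Dw ^+ 2).
Proof.
move=> sv sw sDv sDw.
have sB i : L2 Om (component (fun x => v x - w x) i).
  exact: (sq_integrable_mxB mOm (sv i) (sw i)).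
have sDB i j : L2 Om (entry (fun x => Dv x - Dw x) i j).
  exact: (sq_integrable_mxB mOm (sDv i j) (sDw i j)).
rewrite !sqr_H1norm//.
rewrite [X in 2 * X]addrACA mulrDr lerD//.
  rewrite -big_split mulr_sumr; apply: ler_sum => i _ /=.
  exact: (ip_mxB_le mOm (sv i) (sw i)).
rewrite -big_split mulr_sumr; apply: ler_sum => i _ /=.
rewrite -big_split mulr_sumr; apply: ler_sum => j _ /=.
exact: (ip_mxB_le mOm (sDv i j) (sDw i j)).
Qed.

(** Each squared component norm is one term of a sum of nonnegative terms, hence at most the squared
    [H1norm]. *)
Lemma H01_dense (v : H01 Om) (e : R) : 0 < e ->
  exists phi : 'rV[R]_n -> 'rV[R]_n,
  [/\ forall i, test_function Om (component phi i),
      forall i, normOm (fun x => v x ord0 i - phi x ord0 i) <= e &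
      forall i j, normOm (fun x => grad v x i j - partial j (component phi i) x) <= e].
Proof.
move=> e0; have [phi [tphi phie]] := H01_approx v e0.
have Hv i : (fun x => (v x - phi x) ord0 i) = (fun x => v x ord0 i - phi x ord0 i).
  by apply/funext => x; rewrite !mxE.
have HD i j : (fun x => (grad v x - jac phi x) i j) =
    (fun x => grad v x i j - partial j (component phi i) x).
  by apply/funext => x; rewrite !mxE.
have sv i : L2 Om (fun x => (v x - phi x) ord0 i).
  exact: (sq_integrable_mxB mOm (H1_fun_L2 v i) (sq_test (tphi i))).
have sJ i j : L2 Om (fun x => jac phi x i j) by exact: L2_jac.
have sD i j : L2 Om (fun x => (grad v x - jac phi x) i j).
  exact: (sq_integrable_mxB mOm (grad_L2 v i j) (sJ i j)).
have : H1norm Om (fun x => v x - phi x) (fun x => grad v x - jac phi x) ^+ 2 <= e ^+ 2.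
  by rewrite ler_sqr ?nnegrE ?sqrtr_ge0 ?ltW.
rewrite sqr_H1norm// => le_e.
have l2_le f : ipOm f f <= e ^+ 2 -> normOm f <= e.
  by move=> fe; rewrite -[leRHS]gtr0_norm// -sqrtr_sqr ler_wsqrtr.
have ler_term (F : 'I_n -> R) i : (forall i, 0 <= F i) -> F i <= \sum_i F i.
  by move=> F0; rewrite (bigD1 i)//= lerDl sumr_ge0.
exists phi; split => // [i|i j]; apply: l2_le; apply: le_trans le_e.
  rewrite -Hv; apply: le_trans (ler_wpDr _ (lexx _)).
    by apply: ler_term => k; exact: ip_ge0.
  by do 2 (apply: sumr_ge0 => ? _); exact: ip_ge0.
rewrite -HD; apply: le_trans (ler_wpDl _ (lexx _)).
  apply: le_trans (ler_term _ i _); last first.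
    by move=> k; apply: sumr_ge0 => ? _; exact: ip_ge0.
  apply: (ler_term (fun j => ipOm (entry (fun x => grad v x - jac phi x) i j) _)).
  by move=> k; exact: ip_ge0.
by apply: sumr_ge0 => ? _; exact: ip_ge0.
Qed.

Lemma ip_grad_test (v : H1 Om) i j psi : test_function Om psi ->
  ipOm (entry (grad v) i j) psi = - ipOm (component v i) (partial j psi).
Proof. by move=> /(@grad_weak _ _ _ v i j) /(congr1 -%R); rewrite opprK => /esym. Qed.

Lemma eq0_small (C X : R) : (forall e, 0 < e -> `|X| <= C * e) -> X = 0.
Proof.
move=> H; apply/eqP; rewrite -normr_le0; apply/ler_addgt0Pl => e e0; rewrite addr0.
(* [C] has no prescribed sign, so the division is by [|C| + 1]. *)
have C0 : 0 < `|C| + 1 by rewrite ltr_wpDl.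
have := H (e / (`|C| + 1)) (divr_gt0 e0 C0).
move=> /le_trans; apply; rewrite mulrCA ger_pMr// ler_pdivrMr// mul1r.
by rewrite (le_trans (ler_norm _))// lerDl.
Qed.

Lemma ip_sub_le (e : R) f g h : L2 Om f -> L2 Om g -> L2 Om h ->
  normOm (fun x => g x - h x) <= e ->
  `|ipOm f (fun x => g x - h x)| <= normOm f * e.
Proof.
move=> sf sg sh ghe; rewrite (le_trans (cauchy_schwarz _ _ _))//.
  exact: sq_integrableB.
by rewrite ler_wpM2l ?sqrtr_ge0.
Qed.

(** Only the second factor of each product is approximated by derivatives of a test field; the first
    stays a weak derivative of the component [v_i], so the error is linear in [e]. *)
Lemma grad_swap (v : H01 Om) i j :
  ipOm (entry (grad v) i j) (entry (grad v) j i) =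
  ipOm (entry (grad v) i i) (entry (grad v) j j).
Proof.
set a := entry (grad v) i j; set b := entry (grad v) j i.
set c := entry (grad v) i i; set d := entry (grad v) j j.
have [sa sb sc sd] : [/\ L2 Om a, L2 Om b, L2 Om c & L2 Om d].
  by split; exact: grad_L2.
apply/eqP; rewrite -subr_eq0; apply/eqP.
apply: (@eq0_small (normOm a + normOm c)) => e e0.
have [phi [tphi _ phie]] := H01_dense v e0.
set p := partial i (component phi j); set q := partial j (component phi j).
have sp : L2 Om p by apply: sq_test; exact: test_function_partial.
have sq : L2 Om q by apply: sq_test; exact: test_function_partial.
(* For the approximant the identity is exact: both sides equal minus the integral of [v_i] against
   the same second derivative of [phi_j]. *)
have apcq : ipOm a p = ipOm c q.
  transitivity (- ipOm (component v i) (partial j p)).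
    by apply: ip_grad_test; exact: test_function_partial.
  transitivity (- ipOm (component v i) (partial i q)); last first.
    by apply/esym/ip_grad_test; exact: test_function_partial.
  suff -> : partial j p = partial i q by [].
  by apply/funext => x; apply: partial_comm; case: (tphi j).
have pb : normOm (fun x => b x - p x) <= e by exact: phie.
have qd : normOm (fun x => d x - q x) <= e by exact: phie.
clearbody a b c d p q.
have -> : ipOm a b - ipOm c d = ipOm a (fun x => b x - p x) - ipOm c (fun x => d x - q x).
  by rewrite !ipBr// apcq opprB addrA subrK.
rewrite (le_trans (ler_normB _ _))// mulrDl lerD// ip_sub_le//.
Qed.

Lemma poincare (v : H01 Om) (i k : 'I_n) (M : R) : 0 < M ->
  (forall x, Om x -> `|x ord0 k| <= M) ->
  ipOm (component v i) (component v i) <=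
    4 * M ^+ 2 * ipOm (entry (grad v) i k) (entry (grad v) i k).
Proof.
move=> M0 kM; set w := component v i; set d := entry (grad v) i k.
have sw : L2 Om w by exact: H1_fun_L2.
have sd : L2 Om d by exact: grad_L2.
have mk : measurable_fun Om (fun x : 'rV[R]_n => x ord0 k).
  by apply: measurable_funTS; exact: measurable_coord.
pose xw (x : 'rV[R]_n) := x ord0 k * w x.
pose xd (x : 'rV[R]_n) := x ord0 k * d x.
have sxw : L2 Om xw by exact: sq_integrable_bM kM sw.
have sxd : L2 Om xd by exact: sq_integrable_bM kM sd.
have xwd : ipOm xd w = ipOm xw d.
  by apply: eq_Rintegral => x _; rewrite /xd /xw -mulrA (mulrC (d x)) mulrA.
(* Formally this is the vanishing integral of the [k]-th derivative of [x_k w^2]. *)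
have E0 : ipOm w w + ipOm xw d + ipOm xd w = 0.
  apply: (@eq0_small (normOm w + normOm xw + normOm xd)) => e e0.
  have [phi [tphi phie dphie]] := H01_dense v e0.
  set f := component phi i; set g := partial k f.
  have tf : test_function Om f by exact: tphi.
  have sf : L2 Om f by exact: sq_test.
  have sg : L2 Om g by apply: sq_test; exact: test_function_partial.
  have sxg : L2 Om (fun x : 'rV[R]_n => x ord0 k * g x) by exact: sq_integrable_bM kM sg.
  (* The weak gradient is tested with [x_k f], whose [k]-th derivative is [f + x_k g]. *)
  have E : ipOm w f + ipOm xw g + ipOm xd f = 0.
    apply/eqP; rewrite addr_eq0.
    rewrite -(_ : ipOm d (fun x : 'rV[R]_n => x ord0 k * f x) = ipOm xd f); last first.
      by apply: eq_Rintegral => x _; rewrite /xd mulrA (mulrC (d x)).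
    rewrite [X in - X](@ip_grad_test v i k _ (test_function_coordM k tf)) opprK.
    apply/eqP; rewrite -[LHS]RintegralD//; try exact: integrable_sqM.
    apply: eq_Rintegral => x _; rewrite partial_coordM ?eqxx ?mul1r.
      by rewrite mulrDr; congr (_ + _); rewrite mulrCA mulrA.
    by case: tf => tf _ _; exact: smooth_differentiable.
  have we : normOm (fun x => w x - f x) <= e by exact: phie.
  have de : normOm (fun x => d x - g x) <= e by exact: dphie.
  clearbody f g xw xd w d.
  rewrite -[X in `|X|]subr0 -{}E.
  have -> : ipOm w w + ipOm xw d + ipOm xd w - (ipOm w f + ipOm xw g + ipOm xd f) =
      ipOm w (fun x => w x - f x) + ipOm xw (fun x => d x - g x) +
      ipOm xd (fun x => w x - f x).
    by rewrite !ipBr//; ring.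
  rewrite (le_trans (ler_normD _ _))// mulrDl lerD ?ip_sub_le//.
  by rewrite (le_trans (ler_normD _ _))// mulrDl lerD ?ip_sub_le.
have snd : L2 Om (fun x => -2 * xd x) by exact: sq_integrableZ.
have ww : ipOm w w = ipOm w (fun x => -2 * xd x).
  by rewrite [RHS]ipC ipZl//; move: E0; rewrite xwd; lra.
(* With weight 1/2, half of the squared norm of [w] is absorbed on the left and twice that of
   [x_k d] remains, whence the factor 4. *)
have le_half := ip_young mOm (divr_gt0 ltr01 (ltr0n R 2)) sw snd.
have xd_le : ipOm xd xd <= M ^+ 2 * ipOm d d.
  rewrite /ip -RintegralZl//; last exact: integrable_sqM.
  apply: le_Rintegral => //; try by exact: integrable_sqM.
    by apply: integrable_realZ => //; exact: integrable_sqM.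
  move=> x Omx; rewrite /xd mulrACA -!expr2 ler_wpM2r ?sqr_ge0//.
  by rewrite -real_normK ?num_real// ler_sqr ?nnegrE ?kM// ltW.
rewrite -ww [X in _ + _ * X]ipZl// [X in _ + _ * (_ * X)]ipC ipZl// in le_half.
by lra.
Qed.

(** Korn's inequality with constant 2. The right side is the squared norm of the gradient plus the
    integral of the sum of [D_j v_i D_i v_j], which [grad_swap] turns into the squared norm of
    [div v]. *)
Lemma grad_le_symgrad (v : H01 Om) :
  \sum_i \sum_j ipOm (entry (grad v) i j) (entry (grad v) i j) <=
  2 * \int[lebesgue_rV n]_(x in Om) frob (symgrad v x) (symgrad v x).
Proof.
have sD i j : L2 Om (entry (grad v) i j) by exact: grad_L2.
have iD i j k l := integrable_sqM mOm (sD i j) (sD k l).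
pose G := \sum_i \sum_j ipOm (entry (grad v) i j) (entry (grad v) i j).
have sdiv : L2 Om (div v) by apply: sq_integrable_sum => // i; exact: sD.
have sum_div : \sum_i \sum_j ipOm (entry (grad v) i j) (entry (grad v) j i) =
    ipOm (div v) (div v).
  rewrite [RHS](ip_suml mOm _ (fun i => sD i i) sdiv).
  apply: eq_bigr => i _; rewrite [RHS]ipC (ip_suml mOm _ (fun i => sD i i) (sD i i)).
  by apply: eq_bigr => j _; rewrite grad_swap ipC.
have -> : 2 * \int[lebesgue_rV n]_(x in Om) frob (symgrad v x) (symgrad v x) =
    G + \sum_i \sum_j ipOm (entry (grad v) i j) (entry (grad v) j i).
  transitivity (\sum_i \sum_j (ipOm (entry (grad v) i j) (entry (grad v) i j)
      + ipOm (entry (grad v) i j) (entry (grad v) j i))); last first.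
    by rewrite /G -big_split; apply: eq_bigr => i _; rewrite big_split.
  have -> : \int[lebesgue_rV n]_(x in Om) frob (symgrad v x) (symgrad v x) =
      2^-1 * \int[lebesgue_rV n]_(x in Om) \sum_i \sum_j
        (grad v x i j * grad v x i j + grad v x i j * grad v x j i).
    rewrite -RintegralZl//; last first.
      do 2 (apply: integrable_real_sum => // ?).
      exact: integrable_realD.
    apply: eq_Rintegral => x _; rewrite frobE.
    pose B := grad v x.
    (* The second double sum is the first with its indices exchanged, so the factor 1/4 becomes
       1/2. *)
    have -> : \sum_i \sum_j symgrad v x i j * symgrad v x i j =
      4^-1 * (\sum_i \sum_j (B i j * B i j + B i j * B j i) +
         \sum_i \sum_j (B j i * B j i + B j i * B i j)).
      rewrite -big_split mulr_sumr; apply: eq_bigr => i _ /=.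
      rewrite -big_split mulr_sumr; apply: eq_bigr => j _ /=.
      by rewrite !mxE -/B; field.
    by rewrite [X in _ + X]exchange_big/=; field.
  rewrite mulrA divff ?mul1r// Rintegral_sum//; last first.
    by move=> i; apply: integrable_real_sum => // j; exact: integrable_realD.
  apply: eq_bigr => i _; rewrite Rintegral_sum//; last first.
    by move=> j; exact: integrable_realD.
  by apply: eq_bigr => j _; rewrite RintegralD.
by rewrite sum_div lerDl ip_ge0.
Qed.

End sobolev_estimates.

(** * The penalty estimate *)

Section penalty.
Context {R : realType} {n : nat}.
Variables (Om : set 'rV[R]_n) (Om_open : open Om) (Om_bounded : bounded_set Om).

Let mOm : measurable Om. Proof. exact: open_measurable_rV. Qed.

Local Notation ipOm := (ip (lebesgue_rV n) Om).

Let sq_test h : test_function Om h -> sq_integrable (lebesgue_rV n) Om h.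
Proof. exact: test_function_L2. Qed.

(** Makes the difference of the two solutions an admissible test field, with its gradient known
    exactly. Differences of approximants approximate it. *)
Lemma H01_sub (v u : H01 Om) : exists w : H01 Om,
  H1_fun w = (fun x => v x - u x) /\ grad w = (fun x => grad v x - grad u x).
Proof.
have cE i : (fun x => (v x - u x) ord0 i) = (fun x => v x ord0 i - u x ord0 i).
  by apply/funext => x; rewrite !mxE.
have gE i j : (fun x => (grad v x - grad u x) i j) =
    (fun x => grad v x i j - grad u x i j).
  by apply/funext => x; rewrite !mxE.
have sw i : L2 Om (fun x => (v x - u x) ord0 i).
  exact: (sq_integrable_mxB mOm (H1_fun_L2 v i) (H1_fun_L2 u i)).
have sD i j : L2 Om (fun x => (grad v x - grad u x) i j).
  exact: (sq_integrable_mxB mOm (grad_L2 v i j) (grad_L2 u i j)).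
have wk i j : weak_partial Om j (fun x => (v x - u x) ord0 i)
    (fun x => (grad v x - grad u x) i j).
  move=> psi tpsi.
  rewrite -[LHS]/(ipOm (fun x => (v x - u x) ord0 i) (partial j psi)) cE.
  rewrite -[X in _ = - X]/(ipOm (fun x => (grad v x - grad u x) i j) psi) gE.
  have sp := sq_test tpsi; have sdp := sq_test (test_function_partial j tpsi).
  rewrite (ipBl mOm (H1_fun_L2 v i) (H1_fun_L2 u i) sdp).
  rewrite (ipBl mOm (grad_L2 v i j) (grad_L2 u i j) sp).
  by rewrite !ip_grad_test// opprB opprK addrC.
pose W := MkH1 sw sD wk.
suff HW e : 0 < e -> exists phi : 'rV[R]_n -> 'rV[R]_n,
    (forall i, test_function Om (fun x => phi x ord0 i)) /\
    H1norm Om (fun x => W x - phi x) (fun x => grad W x - jac phi x) < e.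
  by exists (MkH01 HW).
move=> e0; have e2 : 0 < e / 2 by rewrite divr_gt0.
have [phi [tphi phie]] := H01_approx v e2.
have [psi [tpsi psie]] := H01_approx u e2.
have tB i : test_function Om (fun x => (phi x - psi x) ord0 i).
  rewrite (_ : (fun x => _) = (fun x => phi x ord0 i - psi x ord0 i)).
    exact: test_functionB.
  by apply/funext => x; rewrite !mxE.
exists (fun x => phi x - psi x); split => //.
have subrACA (V : zmodType) (a b c d : V) : a - b - (c - d) = a - c - (b - d).
  by rewrite !opprB addrACA [RHS]addrACA [- b + _]addrC.
have jacB x : jac (fun x => phi x - psi x) x = jac phi x - jac psi x.
  apply/matrixP => i j; rewrite !mxE -partialB.
    by congr (partial _ _ _); apply/funext => y; rewrite !mxE.
  - by apply: smooth_differentiable; case: (tphi i).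
  - by apply: smooth_differentiable; case: (tpsi i).
rewrite (_ : (fun x => W x - _) = (fun x => (v x - phi x) - (u x - psi x))); last first.
  by apply/funext => x /=; rewrite [LHS]subrACA.
rewrite (_ : (fun x => grad W x - _) =
    (fun x => (grad v x - jac phi x) - (grad u x - jac psi x))); last first.
  by apply/funext => x /=; rewrite jacB [LHS]subrACA.
have sv i : L2 Om (fun x => (v x - phi x) ord0 i).
  exact: (sq_integrable_mxB mOm (H1_fun_L2 v i) (sq_test (tphi i))).
have su i : L2 Om (fun x => (u x - psi x) ord0 i).
  exact: (sq_integrable_mxB mOm (H1_fun_L2 u i) (sq_test (tpsi i))).
have sDv i j : L2 Om (fun x => (grad v x - jac phi x) i j).
  exact: (sq_integrable_mxB mOm (grad_L2 v i j) (L2_jac Om_open Om_bounded i j tphi)).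
have sDu i j : L2 Om (fun x => (grad u x - jac psi x) i j).
  exact: (sq_integrable_mxB mOm (grad_L2 u i j) (L2_jac Om_open Om_bounded i j tpsi)).
(* The choice [e / 2] is exactly what the factor 2 of [sqr_H1normB_le] calls for. *)
have le2 (a b : R) : 0 <= a -> 0 <= b -> a < e / 2 -> b < e / 2 ->
    2 * (a ^+ 2 + b ^+ 2) < e ^+ 2.
  move=> a0 b0; rewrite -[a < _]ltr_sqr ?nnegrE ?(ltW e2)// => ae.
  rewrite -[b < _]ltr_sqr ?nnegrE ?(ltW e2)// => be.
  have -> : e ^+ 2 = 2 * ((e / 2) ^+ 2 + (e / 2) ^+ 2) by field.
  by rewrite ltr_pM2l// ltrD.
rewrite -ltr_sqr ?nnegrE ?sqrtr_ge0 ?ltW//.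
rewrite (le_lt_trans (sqr_H1normB_le Om_open sv su sDv sDu))//.
exact: (le2 _ _ (sqrtr_ge0 _) (sqrtr_ge0 _) phie psie).
Qed.

Lemma symgrad_L2 (v : H1 Om) i j : L2 Om (fun x => symgrad v x i j).
Proof.
rewrite (_ : (fun x => _) = (fun x => 2^-1 * (grad v x i j + grad v x j i))).
  apply: sq_integrableZ => //; apply: sq_integrableD => //; exact: grad_L2.
by apply/funext => x; rewrite !mxE.
Qed.

Lemma div_L2 (v : H1 Om) : L2 Om (div v).
Proof. by apply: sq_integrable_sum => // i; exact: grad_L2. Qed.

Lemma integrable_frob (v w : H1 Om) : (lebesgue_rV n).-integrable Om
  (EFin \o (fun x => frob (symgrad v x) (symgrad w x))).
Proof.
under eq_fun do rewrite frobE.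
do 2 (apply: integrable_real_sum => // ?).
by apply: integrable_sqM => //; exact: symgrad_L2.
Qed.

Lemma measurable_frob (v w : H1 Om) :
  measurable_fun Om (fun x => frob (symgrad v x) (symgrad w x)).
Proof. by apply/measurable_EFinP; case/integrableP : (integrable_frob v w). Qed.

(** The denominator is at least [g], so the integrand is dominated by [g^-1] times an integrable
    function. *)
Lemma integrable_frob_max (g beta : R) (v w : H1 Om) : 0 < g ->
  (lebesgue_rV n).-integrable Om (EFin \o (fun x =>
    frob (symgrad v x) (symgrad w x) / Num.max g (beta * frobnorm (symgrad v x)))).
Proof.
(* Measurability: the inverse denominator is this continuous function of the squared norm of
   [symgrad v x]. *)
move=> g0; pose c (s : R) := (Num.max g (beta * Num.sqrt s))^-1.
have cc : continuous c.
  move=> s; apply: cvgV; first by rewrite gt_eqF// lt_max g0.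
  apply: (@continuous_max _ _ (cst g) (fun t => beta * Num.sqrt t)).
    exact: cvg_cst.
  by apply: cvgM; [exact: cvg_cst|exact: sqrt_continuous].
apply: (@le_integrable_real _ _ _ (lebesgue_rV n) Om mOm _
  (fun x => g^-1 * `|frob (symgrad v x) (symgrad w x)|)).
- apply: measurable_funM; first exact: measurable_frob.
  apply: (measurableT_comp (continuous_measurable_fun cc)).
  exact: measurable_frob.
- apply: integrable_realZ => //; apply: integrable_norm.
  exact: integrable_frob.
- move=> x _; rewrite normrM mulrC ler_wpM2r// gtr0_norm ?invr_gt0 ?lt_max ?g0//.
  by rewrite lef_pV2 ?posrE ?lt_max ?g0// le_max lexx.
Qed.

(** Here [v] is the penalized solution and [w] stands for [v - u]. The load is an abstract [l]
    because its value at [w] cancels between the two equations. *)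
Lemma penalty_error (mu g beta nu : R) (l : H01 Om -> R) (v u w : H01 Om)
    (p : 'rV[R]_n -> R) :
  0 < g -> 0 < beta -> 0 < nu -> L2 Om p ->
  grad w = (fun x => grad v x - grad u x) ->
  {ae lebesgue_rV n, forall x, Om x -> div u x = 0} ->
  mu * \int[lebesgue_rV n]_(x in Om) frob (symgrad v x) (symgrad w x)
    + g * beta * \int[lebesgue_rV n]_(x in Om)
       (frob (symgrad v x) (symgrad w x) / Num.max g (beta * frobnorm (symgrad v x)))
    + nu * ipOm (div v) (div w) = l w ->
  mu * \int[lebesgue_rV n]_(x in Om) frob (symgrad u x) (symgrad w x)
    + g * beta * \int[lebesgue_rV n]_(x in Om)
       (frob (symgrad u x) (symgrad w x) / Num.max g (beta * frobnorm (symgrad u x)))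
    - ipOm p (div w) = l w ->
  mu * \int[lebesgue_rV n]_(x in Om) frob (symgrad w x) (symgrad w x) <=
  (4 * nu)^-1 * ipOm p p.
Proof.
(* The final arithmetic, stated on real variables so that [lra] sees no integrals. *)
have absorb (A1 A2 B1 B2 D P Q N L : R) :
    mu * A1 + g * beta * B1 + nu * D = L -> mu * A2 + g * beta * B2 - P = L ->
    A1 - A2 = Q -> 0 <= g * beta * (B1 - B2) -> - P <= nu * D + N ->
    mu * Q <= N.
  by move=> E1 E2 <-; rewrite !mulrBr; lra.
move=> g0 b0 nu0 sp wE u0 Ev Eu.
have symw x : symgrad w x = symgrad v x - symgrad u x.
  rewrite /symgrad wE; apply/matrixP => i j; rewrite !mxE; ring.
have divw : div w = (fun x => div v x - div u x).
  by apply/funext => x; rewrite /div wE raddfB.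
have sd : L2 Om (div w) by exact: div_L2.
have hA : \int[lebesgue_rV n]_(x in Om) frob (symgrad v x) (symgrad w x) -
    \int[lebesgue_rV n]_(x in Om) frob (symgrad u x) (symgrad w x) =
    \int[lebesgue_rV n]_(x in Om) frob (symgrad w x) (symgrad w x).
  rewrite -RintegralB//; try exact: integrable_frob.
  by apply: eq_Rintegral => x _; rewrite [in RHS]symw frobBl -symw.
have hB : 0 <= \int[lebesgue_rV n]_(x in Om)
       (frob (symgrad v x) (symgrad w x) / Num.max g (beta * frobnorm (symgrad v x)))
    - \int[lebesgue_rV n]_(x in Om)
       (frob (symgrad u x) (symgrad w x) / Num.max g (beta * frobnorm (symgrad u x))).
  rewrite -RintegralB//; try exact: integrable_frob_max.
  by apply: Rintegral_ge0 => x _; rewrite symw; exact: frob_monotone.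
(* The divergence of [u] vanishes only almost everywhere, so the integrand is replaced up to a null
   set. *)
have hu : ipOm (div u) (div w) = 0.
  rewrite /ip /Rintegral (ae_eq_integral (cst 0%E)) ?integral0//.
  - by apply/measurable_EFinP; exact: (measurable_funM (div_L2 u).1 sd.1).
  - by apply: filterS u0 => x ux Omx; rewrite ux// mul0r.
have hD : ipOm (div v) (div w) = ipOm (div w) (div w).
  by rewrite [in X in _ = ipOm X _]divw (ipBl mOm (div_L2 v) (div_L2 u) sd) hu subr0.
have sNp : L2 Om (fun x => -1 * p x) by exact: sq_integrableZ.
(* Young's inequality for [div w] and [-p] with weight [nu]: the divergence term then matches the
   penalty term exactly. *)
have hP : - ipOm p (div w) <= nu * ipOm (div w) (div w) + (4 * nu)^-1 * ipOm p p.
  have := ip_young mOm nu0 sd sNp.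
  rewrite ipC (ipZl mOm _ sp sd) (ipZl mOm _ sp sNp).
  rewrite [ipOm p (fun x => -1 * p x)]ipC (ipZl mOm _ sp sp).
  by rewrite !mulN1r opprK.
have hgB := mulr_ge0 (mulr_ge0 (ltW g0) (ltW b0)) hB.
rewrite hD in Ev; exact: absorb Ev Eu hA hgB hP.
Qed.

(** Poincare in the single direction [k0] bounds [w] by [4 M^2] times its squared gradient; adding
    the gradient itself and applying Korn gives a constant uniform in [w]. *)
Lemma H1norm_le_symgrad (k0 : 'I_n) : exists2 C : R, 0 < C &
  forall w : H01 Om, H1norm Om w (grad w) ^+ 2 <=
    C * \int[lebesgue_rV n]_(x in Om) frob (symgrad w x) (symgrad w x).
Proof.
have [M M0 OmM] := bounded_set_coord Om_bounded.
have C0 : 0 < 4 * M ^+ 2 + 1 by rewrite ltr_wpDl// mulr_ge0// sqr_ge0.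
exists ((4 * M ^+ 2 + 1) * 2) => [|w]; first by rewrite mulr_gt0.
rewrite sqr_H1norm//; [|exact: H1_fun_L2|exact: grad_L2].
rewrite -[leRHS]mulrA.
apply: le_trans (ler_wpM2l (ltW C0) (grad_le_symgrad Om_open Om_bounded w)).
rewrite mulrDl mul1r lerD2r mulr_sumr; apply: ler_sum => i _.
apply: le_trans (poincare Om_open Om_bounded w i M0 (fun x Omx => OmM x Omx k0)) _.
rewrite ler_wpM2l//; first by rewrite mulr_ge0// sqr_ge0.
by rewrite (bigD1 k0)//= lerDl sumr_ge0// => j _; exact: ip_ge0.
Qed.

End penalty.

(** * Convergence of the penalized solutions, with squared error at most [K / nu] *)

Theorem theorem2 (R : realType) (n : nat) (hn : n = 2%N \/ n = 3%N)
    (Om : set 'rV[R]_n) (Om_open : open Om) (Om_bounded : bounded_set Om)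
    (Om_lip : lipschitz_boundary Om)
    (mu g beta : R) (mu_gt0 : 0 < mu) (g_gt0 : 0 < g) (beta_gt0 : 0 < beta)
    (f : 'rV[R]_n -> 'rV[R]_n) (f_cont : continuous_load Om f)
    (unu : R -> H01 Om)
    (unu_sol : forall nu : R, 0 < nu -> forall v : H01 Om,
       mu * \int[lebesgue_rV n]_(x in Om)
              frob (symgrad (unu nu) x) (symgrad v x)
       + g * beta * \int[lebesgue_rV n]_(x in Om)
              (frob (symgrad (unu nu) x) (symgrad v x)
               / Num.max g (beta * frobnorm (symgrad (unu nu) x)))
       + nu * \int[lebesgue_rV n]_(x in Om) (div (unu nu) x * div v x)
       = \int[lebesgue_rV n]_(x in Om) dotv (f x) (v x))
    (u : H01 Om) (p : 'rV[R]_n -> R)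
    (u_div0 : {ae lebesgue_rV n, forall x, Om x -> div u x = 0})
    (p_L20 : L2_0 Om p)
    (u_sol : forall v : H01 Om,
       mu * \int[lebesgue_rV n]_(x in Om) frob (symgrad u x) (symgrad v x)
       + g * beta * \int[lebesgue_rV n]_(x in Om)
              (frob (symgrad u x) (symgrad v x)
               / Num.max g (beta * frobnorm (symgrad u x)))
       - \int[lebesgue_rV n]_(x in Om) (p x * div v x)
       = \int[lebesgue_rV n]_(x in Om) dotv (f x) (v x)) :
  H1dist (unu nu) u @[nu --> +oo] --> (0 : R).
Proof.
have n0 : (0 < n)%N by case: hn => ->.
have [C C0 HC] := H1norm_le_symgrad Om_open Om_bounded (Ordinal n0).
(* [penalty_error] divided by [mu] and multiplied by the constant [C] of [H1norm_le_symgrad], with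
   [1 / nu] taken out. *)
pose K := C * ip (lebesgue_rV n) Om p p / (4 * mu).
have K0 : 0 <= K.
  by apply: divr_ge0; apply: mulr_ge0 => //; try exact: ltW; exact: ip_ge0.
have bound nu : 0 < nu -> H1dist (unu nu) u ^+ 2 <= K / nu.
  move=> nu0; have [w [wE gE]] := H01_sub Om_open Om_bounded (unu nu) u.
  rewrite /H1dist -wE -gE; apply: (le_trans (HC w)).
  have [sp _] := p_L20.
  have := penalty_error (l := fun v => \int[lebesgue_rV n]_(x in Om) dotv (f x) (v x))
    Om_open g_gt0 beta_gt0 nu0 sp gE u_div0 (unu_sol nu nu0 w) (u_sol w).
  set Q := Rintegral _ _ _; set P := ip _ _ p p => Q_le.
  have -> : K / nu = C * ((4 * nu)^-1 * P / mu).
    by rewrite /K -/P; field; rewrite !gt_eqF.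
  by rewrite ler_pM2l// ler_pdivlMr// mulrC.
apply/cvgrPdist_le => e e0; near=> nu.
have nu0 : 0 < nu by near: nu; exact: nbhs_pinfty_gt.
(* From this threshold on, [K / nu] is at most [e ^+ 2]. *)
have Knu : K / e ^+ 2 <= nu by near: nu; apply: nbhs_pinfty_ge; exact: num_real.
rewrite sub0r normrN ger0_norm ?sqrtr_ge0//.
rewrite -ler_sqr ?nnegrE ?sqrtr_ge0 ?(ltW e0)//.
apply: le_trans (bound nu nu0) _.
by rewrite ler_pdivrMr// mulrC -ler_pdivrMr// exprn_gt0.
Unshelve. all: by end_near. Qed.
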